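(* Let $\Theta$ be a first-order signature and $\Gamma\cup\{\varphi\}$ a set of sentences (closed formulas) of $\mathfrak{Fm}_\Theta$. If $\Gamma\models\varphi$, then $\Gamma\vdash\varphi$ in $\mathcal{QH}^{\vee,\triangle}_3$.
   Context: An $H^{\vee,\triangle}_3$-algebra is an algebra $(A,\to,\vee,\triangle,1)$ such that: $(A,\vee,1)$ is a join-semilattice with top $1$; $x\to(x\vee y)=1$ and $(x\to y)\to((x\vee y)\to y)=1$; whenever the infimum $x\wedge y$ exists, $\triangle(x\wedge y)=\triangle x\wedge\triangle y$; $(A,\to,1)$ satisfies $x\to(y\to x)=1$, $(x\to(y\to z))\to((x\to y)\to(x\to z))=1$, ($x\to y=1=y\to x$ implies $x=y$), and $((x\to y)\to z)\to(((z\to x)\to z)\to z)=1$; and $\triangle x\to x=1$, $((y\to\triangle y)\to(x\to\triangle\triangle x))\to\triangle(x\to y)=\triangle x\to\triangle\triangle y$, $(\triangle x\to\triangle y)\to\triangle x=\triangle x$. It is complete if its order ($x\le y$ iff $x\to y=1$) is a complete lattice. $\mathfrak{Fm}_\Theta$ is the set of first-order formulas over signature $\Theta$ built with $\to,\vee,\triangle,\forall,\exists$. $\mathcal{QH}^{\vee,\triangle}_3$ is the Hilbert calculus with: all instances of (Ax1) $\alpha\to(\beta\to\alpha)$; (Ax2) $(\alpha\to(\beta\to\gamma))\to((\alpha\to\beta)\to(\alpha\to\gamma))$; (Ax3) $((\alpha\to\beta)\to\gamma)\to(((\gamma\to\alpha)\to\gamma)\to\gamma)$; (Ax4) $\alpha\to(\alpha\vee\beta)$;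 (Ax5) $\beta\to(\alpha\vee\beta)$; (Ax6) $(\alpha\to\gamma)\to((\beta\to\gamma)\to((\alpha\vee\beta)\to\gamma))$; (Ax7) $\triangle\alpha\to\alpha$; (Ax8) $\triangle(\triangle\alpha\to\beta)\to(\triangle\alpha\to\triangle\beta)$; (Ax9) $((\beta\to\triangle\beta)\to(\alpha\to\triangle(\alpha\to\beta)))\to\triangle(\alpha\to\beta)$; (Ax10) $((\triangle\alpha\to\beta)\to\gamma)\to((\triangle\alpha\to\gamma)\to\gamma)$; (Ax11) $\varphi(x/t)\to\exists x\varphi$ and (Ax12) $\forall x\varphi\to\varphi(x/t)$ for $t$ free for $x$ in $\varphi$; (Ax13) both implications between $\triangle\exists x\varphi$ and $\exists x\triangle\varphi$; (Ax14) both implications between $\triangle\forall x\varphi$ and $\forall x\triangle\varphi$; rules: modus ponens, necessitation (from $\alpha$ infer $\triangle\alpha$), (R3) from $\varphi\to\psi$ infer $\exists x\varphi\to\psi$ if $x$ not free in $\psi$, (R4) from $\varphi\to\psi$ infer $\varphi\to\forall x\psi$ if $x$ not free in $\varphi$. A $\Theta$-structure $\mathfrak{S}=\langle A,S,\cdot^{\mathfrak S}\rangle$: $A$ a complete $H^{\vee,\triangle}_3$-algebra, $S\neq\emptyset$, constants interpreted in $S$, $n$-ary function symbols as $S^n\to S$, $n$-ary predicates as $S^n\to A$. For $v:Var\to S$, $\|\cdot\|_v$ is defined as usual on terms, atomic formulas via the predicate maps, commutes with $\to,\vee,\triangle$, and $\|\forall x\alpha\|_v=\bigwedge_{a\in S}\|\alpha\|_{v[x\to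 a]}$, $\|\exists x\alpha\|_v=\bigvee_{a\in S}\|\alpha\|_{v[x\to a]}$. $\varphi$ is true in $\mathfrak S$ if $\|\varphi\|_v=1$ for all $v$; $\Gamma\models\varphi$ means every structure in which all members of $\Gamma$ are true makes $\varphi$ true. *)

(* Defs.v *)
From mathcomp Require Import all_boot.
From Stdlib Require Import ClassicalEpsilon.

Set Implicit Arguments.
Unset Strict Implicit.
Unset Printing Implicit Defensive.

(** * Algebras *)

Section Bounds.
Variables (A : Type) (le : A -> A -> Prop).

Definition is_glb (X : A -> Prop) (m : A) : Prop :=
  (forall x, X x -> le m x) /\
  (forall l, (forall x, X x -> le l x) -> le l m).

Definition is_lub (X : A -> Prop) (m : A) : Prop :=
  (forall x, X x -> le x m) /\
  (forall u, (forall x, X x -> le x u) -> le m u).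

Definition is_meet (x y m : A) : Prop := is_glb (fun z => z = x \/ z = y) m.

End Bounds.

Record H3alg := MkH3alg {
  carrier :> Type;
  aimp : carrier -> carrier -> carrier;
  ajoin : carrier -> carrier -> carrier;
  atri : carrier -> carrier;
  aone : carrier;
  ajoinA : forall x y z, ajoin x (ajoin y z) = ajoin (ajoin x y) z;
  ajoinC : forall x y, ajoin x y = ajoin y x;
  ajoinxx : forall x, ajoin x x = x;
  ajoinx1 : forall x, ajoin x aone = aone;
  aimp_join : forall x y, aimp x (ajoin x y) = aone;
  aimp_joinl : forall x y, aimp (aimp x y) (aimp (ajoin x y) y) = aone;
  (* [x] and [y] need not have an infimum; when they do, [atri] preserves it *)
  atri_meet : forall x y m,
    is_meet (fun a b => aimp a b = aone) x y m ->
    is_meet (fun a b => aimp a b = aone) (atri x) (atri y) (atri m);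
  aimpK : forall x y, aimp x (aimp y x) = aone;
  aimpS : forall x y z,
    aimp (aimp x (aimp y z)) (aimp (aimp x y) (aimp x z)) = aone;
  aimp_anti : forall x y, aimp x y = aone -> aimp y x = aone -> x = y;
  aimp3 : forall x y z,
    aimp (aimp (aimp x y) z) (aimp (aimp (aimp z x) z) z) = aone;
  atri_le : forall x, aimp (atri x) x = aone;
  atri_imp : forall x y,
    aimp (aimp (aimp y (atri y)) (aimp x (atri (atri x)))) (atri (aimp x y))
    = aimp (atri x) (atri (atri y));
  atri_peirce : forall x y,
    aimp (aimp (atri x) (atri y)) (atri x) = atri x
}.

Definition ale (A : H3alg) (x y : A) : Prop := aimp x y = aone A.

Definition complete (A : H3alg) : Prop :=
  forall X : A -> Prop,
    (exists m, is_glb (@ale A) X m) /\ (exists m, is_lub (@ale A) X m).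

(* The infimum and supremum of a set; they are meaningful as soon as they
   exist, in particular in a complete algebra, and unique by [aimp_anti]. *)
Definition ainf (A : H3alg) (X : A -> Prop) : A :=
  epsilon (inhabits (aone A)) (is_glb (@ale A) X).
Definition asup (A : H3alg) (X : A -> Prop) : A :=
  epsilon (inhabits (aone A)) (is_lub (@ale A) X).

(** * Syntax *)

Record signature := MkSignature {
  csym : Type;
  fsym : Type;
  psym : Type;
  far : fsym -> nat;
  par : psym -> nat
}.

(* Individual variables are indexed by [nat]; an n-tuple of terms is a
   function on ['I_n]. *)
Inductive term (Th : signature) : Type :=
| Var (x : nat)
| Cst (c : csym Th)
| Fun (f : fsym Th) (ts : 'I_(far f) -> term Th).

Inductive formula (Th : signature) : Type :=
| Atom (P : psym Th) (ts : 'I_(par P) -> term Th)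
| Imp (a b : formula Th)
| Or (a b : formula Th)
| Tri (a : formula Th)
| All (x : nat) (a : formula Th)
| Ex (x : nat) (a : formula Th).

Arguments Var {Th} x.
Arguments Cst {Th} c.
Arguments Fun {Th} f ts.
Arguments Atom {Th} P ts.

Section Syntax.
Variable Th : signature.

Fixpoint occurs (x : nat) (t : term Th) : Prop :=
  match t with
  | Var y => x = y
  | Cst _ => False
  | Fun f ts => exists i, occurs x (ts i)
  end.

Fixpoint free (x : nat) (a : formula Th) : Prop :=
  match a with
  | Atom P ts => exists i, occurs x (ts i)
  | Imp b c | Or b c => free x b \/ free x c
  | Tri b => free x b
  | All y b | Ex y b => x <> y /\ free x b
  end.

Definition sentence (a : formula Th) : Prop := forall x, ~ free x a.

Fixpoint tsubst (x : nat) (s t : term Th) : term Th :=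
  match t with
  | Var y => if y == x then s else Var y
  | Cst c => Cst c
  | Fun f ts => Fun f (fun i => tsubst x s (ts i))
  end.

(* [fsubst x t a] replaces the free occurrences of [x] in [a] by [t]; bound
   variables are not renamed, so it is only used when [free_for x t a]. *)
Fixpoint fsubst (x : nat) (t : term Th) (a : formula Th) : formula Th :=
  match a with
  | Atom P ts => Atom P (fun i => tsubst x t (ts i))
  | Imp b c => Imp (fsubst x t b) (fsubst x t c)
  | Or b c => Or (fsubst x t b) (fsubst x t c)
  | Tri b => Tri (fsubst x t b)
  | All y b => if y == x then All y b else All y (fsubst x t b)
  | Ex y b => if y == x then Ex y b else Ex y (fsubst x t b)
  end.

(* No free occurrence of [x] in [a] is in the scope of a quantifier binding
   a variable of [t]. *)
Fixpoint free_for (x : nat) (t : term Th) (a : formula Th) : Prop :=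
  match a with
  | Atom _ _ => True
  | Imp b c | Or b c => free_for x t b /\ free_for x t c
  | Tri b => free_for x t b
  | All y b | Ex y b =>
      ~ free x (All y b) \/ (~ occurs y t /\ free_for x t b)
  end.

End Syntax.

(** * The Hilbert calculus *)

Inductive QH3_axiom (Th : signature) : formula Th -> Prop :=
| Ax1 a b : QH3_axiom (Imp a (Imp b a))
| Ax2 a b c :
    QH3_axiom (Imp (Imp a (Imp b c)) (Imp (Imp a b) (Imp a c)))
| Ax3 a b c :
    QH3_axiom (Imp (Imp (Imp a b) c) (Imp (Imp (Imp c a) c) c))
| Ax4 a b : QH3_axiom (Imp a (Or a b))
| Ax5 a b : QH3_axiom (Imp b (Or a b))
| Ax6 a b c : QH3_axiom (Imp (Imp a c) (Imp (Imp b c) (Imp (Or a b) c)))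
| Ax7 a : QH3_axiom (Imp (Tri a) a)
| Ax8 a b :
    QH3_axiom (Imp (Tri (Imp (Tri a) b)) (Imp (Tri a) (Tri b)))
| Ax9 a b :
    QH3_axiom (Imp (Imp (Imp b (Tri b)) (Imp a (Tri (Imp a b))))
                   (Tri (Imp a b)))
| Ax10 a b c :
    QH3_axiom (Imp (Imp (Imp (Tri a) b) c) (Imp (Imp (Tri a) c) c))
| Ax11 x t a : free_for x t a -> QH3_axiom (Imp (fsubst x t a) (Ex x a))
| Ax12 x t a : free_for x t a -> QH3_axiom (Imp (All x a) (fsubst x t a))
| Ax13l x a : QH3_axiom (Imp (Tri (Ex x a)) (Ex x (Tri a)))
| Ax13r x a : QH3_axiom (Imp (Ex x (Tri a)) (Tri (Ex x a)))
| Ax14l x a : QH3_axiom (Imp (Tri (All x a)) (All x (Tri a)))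
| Ax14r x a : QH3_axiom (Imp (All x (Tri a)) (Tri (All x a))).

Inductive derivable (Th : signature) (G : formula Th -> Prop) :
    formula Th -> Prop :=
| Hyp a : G a -> derivable G a
| Axm a : QH3_axiom a -> derivable G a
| MP a b : derivable G a -> derivable G (Imp a b) -> derivable G b
| Nec a : derivable G a -> derivable G (Tri a)
| R3 x a b : ~ free x b ->
    derivable G (Imp a b) -> derivable G (Imp (Ex x a) b)
| R4 x a b : ~ free x a ->
    derivable G (Imp a b) -> derivable G (Imp a (All x b)).

(** * Semantics *)

Record structure (Th : signature) := MkStructure {
  alg : H3alg;
  alg_complete : complete alg;
  dom : Type;
  dom_inhabited : inhabited dom;
  icst : csym Th -> dom;
  ifun : forall f : fsym Th, ('I_(far f) -> dom) -> dom;
  ipred : forall P : psym Th, ('I_(par P) -> dom) -> alg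
}.

Section Semantics.
Variables (Th : signature) (M : structure Th).

Definition update (v : nat -> dom M) (x : nat) (d : dom M) : nat -> dom M :=
  fun y => if y == x then d else v y.

Fixpoint tval (v : nat -> dom M) (t : term Th) : dom M :=
  match t with
  | Var x => v x
  | Cst c => icst M c
  | Fun f ts => ifun (fun i => tval v (ts i))
  end.

Fixpoint fval (v : nat -> dom M) (a : formula Th) : alg M :=
  match a with
  | Atom P ts => ipred (fun i => tval v (ts i))
  | Imp b c => aimp (fval v b) (fval v c)
  | Or b c => ajoin (fval v b) (fval v c)
  | Tri b => atri (fval v b)
  | All x b => ainf (fun m => exists d, m = fval (update v x d) b)
  | Ex x b => asup (fun m => exists d, m = fval (update v x d) b)
  end.

Definition true_in (a : formula Th) : Prop :=
  forall v : nat -> dom M, fval v a = aone (alg M).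

End Semantics.

Definition entails (Th : signature) (G : formula Th -> Prop)
    (a : formula Th) : Prop :=
  forall M : structure Th, (forall g, G g -> true_in M g) -> true_in M a.

(* Main.v *)
(** The calculus is not complete for the three-element chain alone: without
    conjunction R4 does not yield
    [forall x (Tri H -> b) -> (Tri H -> forall x b)], and this formula is indeed
    refuted in a finite algebra where infima are not pointwise.  The
    counter-model therefore takes its truth values in a completion of the
    Lindenbaum algebra.

    Propositionally, every underivable formula is refuted by a homomorphism to
    the chain [v0 < vh < v1] sending all theorems to [v1].  Finite satisfiable
    sets of constraints on the values of sentences form a forcing poset, and
    truth values are three-valued names over it.  All operations are pointwise,
    so the algebra identities reduce to finite checks, and suprema are computed
    densely.  A name is admitted only if, wherever it is forced to be [vh], some
    sentence below it is forced to be [vh] too; with this restriction a lower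
    bound of all [a(t)] is already below [forall x a], because rule R4 applies to
    the witnessing sentence.  Individuals are the closed terms over the signature
    enlarged by countably many constants, which serve as eigenvariables. *)

From mathcomp Require Import all_boot.
From Stdlib Require Import ClassicalEpsilon.
From mathcomp Require Import boolp classical_sets.
Require Import Defs.

Set Implicit Arguments.
Unset Strict Implicit.
Unset Printing Implicit Defensive.

(** * Three-valued names over a forcing poset *)

Inductive V3 := v0 | vh | v1.

Definition imp3 (i j : V3) : V3 :=
  match i, j with
  | v0, _ | vh, vh | _, v1 => v1
  | v1, vh => vh
  | _, v0 => v0
  end.

Definition or3 (i j : V3) : V3 :=
  match i, j with
  | v0, k | k, v0 => k
  | vh, vh => vh
  | _, _ => v1
  end.

Definition tri3 (i : V3) : V3 := if i is v1 then v1 else v0.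

Definition le3 (i j : V3) : Prop := imp3 i j = v1.

Lemma imp3_v1 i : imp3 i v1 = v1.
Proof. by case: i. Qed.

Lemma le3_anti i j : le3 i j -> le3 j i -> i = j.
Proof. by case: i; case: j. Qed.

Lemma le3_trans i j k : le3 i j -> le3 j k -> le3 i k.
Proof. by case: i; case: j; case: k. Qed.

Lemma le3_total i j : le3 i j \/ le3 j i.
Proof. by case: i; case: j; (left; reflexivity) || (right; reflexivity). Qed.

Section Names.
Variables (P : Type) (le : P -> P -> Prop).
Hypothesis le_refl : forall p, le p p.
Hypothesis le_trans : forall p q r, le p q -> le q r -> le p r.
Variables (G : Type) (gval : G -> P -> V3 -> Prop).
Hypothesis gval_mono : forall g p q k, le q p -> gval g p k -> gval g q k.

(** Only values decided at a common condition are compared, so the definition also applies to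
    relations that are not names. *)
Definition below (r s : P -> V3 -> Prop) : Prop :=
  forall p i j, r p i -> s p j -> le3 i j.

(* The witnesses among the generators keep the infima of generators from
   growing in the algebra of names; without [forces_wit] infima would be
   pointwise. *)
Record name := MkName {
  forces :> P -> V3 -> Prop;
  forces_mono : forall p q k, le q p -> forces p k -> forces q k;
  forces_reg : forall p k,
    (forall q, le q p -> exists2 r, le r q & forces r k) -> forces p k;
  forces_fun : forall p i j, forces p i -> forces p j -> i = j;
  forces_dec : forall p, exists q k, le q p /\ forces q k;
  forces_wit : forall p, forces p vh ->
    exists q g, [/\ le q p, below (gval g) forces & gval g q vh]
}.

Lemma name_ext (m n : name) : (forall p k, m p k <-> n p k) -> m = n.
Proof.
case: m n => [f a1 a2 a3 a4 a5] [g b1 b2 b3 b4 b5] /= e.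
have E : f = g by apply: funext => p; apply: funext => k; apply: propext.
case: _ / E b1 b2 b3 b4 b5 => b1 b2 b3 b4 b5.
by congr MkName; apply: Prop_irrelevance.
Qed.

(** Common values on a dense set suffice: a value forced at [p] by one name is, by [forces_fun],
    forced by the other densely below [p], and [forces_reg] brings it back to [p]. *)
Lemma name_eq (m n : name) :
  (forall p, exists q k, [/\ le q p, m q k & n q k]) -> m = n.
Proof.
move=> e; apply: name_ext => p k; split=> h; apply: forces_reg => q qp;
  have [r [i [rq mi ni]]] := e q; exists r => //.
- by rewrite (forces_fun (forces_mono (le_trans rq qp) h) mi).
- by rewrite (forces_fun (forces_mono (le_trans rq qp) h) ni).
Qed.

Definition dense_closure (r : P -> V3 -> Prop) (p : P) (k : V3) : Prop :=
  forall q, le q p -> exists2 s, le s q & r s k.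

Section MkDense.
Variable r : P -> V3 -> Prop.
Hypothesis r_mono : forall p q k, le q p -> r p k -> r q k.
Hypothesis r_fun : forall p i j, r p i -> r p j -> i = j.
Hypothesis r_dec : forall p, exists q k, le q p /\ r q k.
Hypothesis r_wit : forall p, r p vh ->
  exists q g, [/\ le q p, below (gval g) r & gval g q vh].

Lemma dense_closure_incl p k : r p k -> dense_closure r p k.
Proof. by move=> h q qp; exists q => //; apply: r_mono qp h. Qed.

(** A relation given by a table of values may fail to be regular; the dense closure repairs this and
    preserves the other clauses. *)
Definition dense_name : name.
Proof.
refine (@MkName (dense_closure r) _ _ _ _ _).
- by move=> p q k qp h s sq; apply: h; apply: le_trans sq qp.
- move=> p k h q qp; have [s sq hs] := h q qp.
  have [t ts rt] := hs s (le_refl s); exists t => //; exact: le_trans ts sq.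
- move=> p i j hi hj; have [q qp ri] := hi p (le_refl p).
  have [s sq rj] := hj q qp; exact: r_fun (r_mono sq ri) rj.
- move=> p; have [q [k [qp rk]]] := r_dec p.
  by exists q, k; split=> //; apply: dense_closure_incl.
- move=> p h; have [q qp rq] := h p (le_refl p).
  have [s [g [sq gr gs]]] := r_wit rq; exists s, g; split=> //.
    exact: le_trans sq qp.
  (* A value of the closure is realised by [r] at a refinement, where [r] can be compared with
     [g]. *)
  move=> t i j gi rj; have [u ut ru] := rj t (le_refl t).
  by apply: (gr u) => //; apply: gval_mono ut gi.
Defined.

Lemma dense_nameP p k : r p k -> dense_name p k.
Proof. exact: dense_closure_incl. Qed.

End MkDense.


Lemma below_nameP (m n : name) :
  (forall p, exists q i j, [/\ le q p, m q i, n q j & le3 i j]) -> below m n.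
Proof.
move=> h p i j mi nj; have [q [i' [j' [qp mi' nj' l]]]] := h p.
by rewrite (forces_fun (forces_mono qp mi) mi') (forces_fun (forces_mono qp nj) nj').
Qed.

Lemma below_trans (r : P -> V3 -> Prop) (m n : name) :
  (forall p q k, le q p -> r p k -> r q k) ->
  below r m -> below m n -> below r n.
Proof.
move=> rm h1 h2 p i j ri nj; have [q [k [qp mk]]] := forces_dec m p.
exact: le3_trans (h1 _ _ _ (rm _ _ _ qp ri) mk) (h2 _ _ _ mk (forces_mono qp nj)).
Qed.

Lemma forces_dec2 (m n : name) p :
  exists q i j, [/\ le q p, m q i & n q j].
Proof.
have [q [i [qp mi]]] := forces_dec m p.
have [r [j [rq nj]]] := forces_dec n q.
by exists r, i, j; split=> //; [apply: le_trans rq qp | apply: forces_mono rq mi].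
Qed.

Lemma forces_dec3 (m n o : name) p :
  exists q i j k, [/\ le q p, m q i, n q j & o q k].
Proof.
have [q [i [j [qp mi nj]]]] := forces_dec2 m n p.
have [r [k [rq ok]]] := forces_dec o q.
by exists r, i, j, k; split=> //;
  [apply: le_trans rq qp | apply: forces_mono rq mi | apply: forces_mono rq nj].
Qed.

(** * Operations on names and the algebra they form *)

Definition const_name (b : bool) : name.
Proof.
refine (@dense_name (fun _ k => k = if b then v1 else v0) _ _ _ _).
- by [].
- by move=> p i j -> ->.
- by move=> p; exists p; case: b; eexists; split=> //.
- by case: b.
Defined.

Definition imp_name (m n : name) : name.
Proof.
refine (@dense_name (fun p k => exists i j, [/\ m p i, n p j & k = imp3 i j]) _ _ _ _).
- move=> p q k qp [i [j [mi nj ->]]]; exists i, j.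
  by split=> //; apply: forces_mono qp _.
- move=> p k k' [i [j [mi nj ->]]] [i' [j' [mi' nj' ->]]].
  by rewrite (forces_fun mi mi') (forces_fun nj nj').
- move=> p; have [q [i [j [qp mi nj]]]] := forces_dec2 m n p.
  by exists q, (imp3 i j); split=> //; exists i, j.
- move=> p [i [j [mi nj e]]].
  (* [imp3] yields [vh] only from [v1] and [vh]; since [n] lies below [imp_name m n], a witness for
     [n] serves. *)
  have [ei ej] : i = v1 /\ j = vh by case: i j e {mi nj} => [] [].
  move: nj; rewrite ej => /forces_wit [q [g [qp gn gq]]].
  exists q, g; split=> // s a k ga [i' [j' [_ nj' ->]]].
  by have := gn _ _ _ ga nj'; case: a i' j' {ga nj'} => [] [] [].
Defined.

Definition or_name (m n : name) : name.
Proof.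
refine (@dense_name (fun p k => exists i j, [/\ m p i, n p j & k = or3 i j]) _ _ _ _).
- move=> p q k qp [i [j [mi nj ->]]]; exists i, j.
  by split=> //; apply: forces_mono qp _.
- move=> p k k' [i [j [mi nj ->]]] [i' [j' [mi' nj' ->]]].
  by rewrite (forces_fun mi mi') (forces_fun nj nj').
- move=> p; have [q [i [j [qp mi nj]]]] := forces_dec2 m n p.
  by exists q, (or3 i j); split=> //; exists i, j.
- move=> p [i [j [mi nj e]]].
  (* Each operand lies below the join, so the witness of an operand valued [vh] serves. *)
  have [ei|ej] : i = vh \/ j = vh.
    by case: i j e {mi nj} => [] [] //; by [left | right].
  - move: mi; rewrite ei => /forces_wit [q [g [qp gm gq]]].
    exists q, g; split=> // s a k ga [i' [j' [mi' _ ->]]].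
    by have := gm _ _ _ ga mi'; case: a i' j' {ga mi'} => [] [] [].
  - move: nj; rewrite ej => /forces_wit [q [g [qp gn gq]]].
    exists q, g; split=> // s a k ga [i' [j' [_ nj' ->]]].
    by have := gn _ _ _ ga nj'; case: a i' j' {ga nj'} => [] [] [].
Defined.

Definition tri_name (m : name) : name.
Proof.
refine (@dense_name (fun p k => exists2 i, m p i & k = tri3 i) _ _ _ _).
- by move=> p q k qp [i mi ->]; exists i => //; apply: forces_mono qp _.
- by move=> p k k' [i mi ->] [i' mi' ->]; rewrite (forces_fun mi mi').
- move=> p; have [q [i [qp mi]]] := forces_dec m p.
  by exists q, (tri3 i); split=> //; exists i.
- by move=> p [[]].
Defined.

Lemma const_nameP b p : const_name b p (if b then v1 else v0).
Proof. exact: dense_nameP. Qed.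

Lemma imp_nameP (m n : name) p i j :
  m p i -> n p j -> imp_name m n p (imp3 i j).
Proof. by move=> mi nj; apply: dense_nameP; exists i, j. Qed.

Lemma or_nameP (m n : name) p i j :
  m p i -> n p j -> or_name m n p (or3 i j).
Proof. by move=> mi nj; apply: dense_nameP; exists i, j. Qed.

Lemma tri_nameP (m : name) p i : m p i -> tri_name m p (tri3 i).
Proof. by move=> mi; apply: dense_nameP; exists i. Qed.

Lemma imp_name1P (m n : name) :
  imp_name m n = const_name true <-> below m n.
Proof.
split=> [e p i j mi nj|h].
  have := imp_nameP mi nj; rewrite e => h.
  exact: forces_fun h (@const_nameP true p).

apply: name_eq => p; have [q [i [j [qp mi nj]]]] := forces_dec2 m n p.
exists q, v1; split=> //; last exact: (const_nameP true).
by rewrite -(h q i j mi nj); apply: imp_nameP.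
Qed.

(** Conditions deciding all three arguments are dense, so an identity between names reduces to one
    between values in the chain. *)
Lemma dense_values (x y z m n : name) :
  (forall q i j k, x q i -> y q j -> z q k ->
    exists u v, [/\ m q u, n q v & u = v]) -> m = n.
Proof.
move=> h; apply: name_eq => p.
have [q [i [j [k [qp xi yj zk]]]]] := forces_dec3 x y z p.
have [u [v [mu nv e]]] := h _ _ _ _ xi yj zk.
by exists q, u; split=> //; rewrite e.
Qed.

Ltac values :=
  repeat (eassumption || eapply (@const_nameP true) || eapply imp_nameP
          || eapply or_nameP || eapply tri_nameP).

Ltac by_values x y z :=
  apply: (@dense_values x y z) => ? ? ? ? ? ? ?; do 2 eexists;
  split; [values | values |];
  match goal with i : V3, j : V3, k : V3 |- _ => by destruct i, j, k end.

Notation one := (const_name true).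
Notation zero := (const_name false).

Lemma tri_name_meet (x y m : name) :
  is_meet (fun a b => imp_name a b = one) x y m ->
  is_meet (fun a b => imp_name a b = one)
    (tri_name x) (tri_name y) (tri_name m).
Proof.
have tri_homo (a b : name) : below a b -> below (tri_name a) (tri_name b).
  move=> ab; apply: below_nameP => p.
  have [q [i [j [qp ai bj]]]] := forces_dec2 a b p.
  exists q, (tri3 i), (tri3 j); split=> //; try exact: tri_nameP.
  by have := ab _ _ _ ai bj; case: i j {ai bj} => [] [].
move=> [lb glb]; split=> [z zxy|l hl].
  apply/imp_name1P; case: zxy => ->; apply: tri_homo; apply/imp_name1P;
    by apply: lb; auto.
(* [zero] gives access to the double negation of [l], a complemented element
   between [l] and both [tri_name x] and [tri_name y]. *)
pose nn := imp_name (imp_name l zero) zero.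
have nnP p i : l p i -> nn p (imp3 (imp3 i v0) v0).
  by move=> li; do 2!(apply: imp_nameP; last exact: (const_nameP false)).
(* Where [l] is not [v0], [tri_name a] cannot be [v0], so [a] is [v1]. *)
have nn_le (a : name) : below l (tri_name a) -> below nn a.
  move=> la; apply: below_nameP => p.
  have [q [i [j [qp li aj]]]] := forces_dec2 l a p.
  exists q, (imp3 (imp3 i v0) v0), j; split=> //; first exact: nnP.
  have := la _ _ _ li (tri_nameP aj).
  by case: i j {li aj} => [] [].
have nm : below nn m.
  apply/imp_name1P; apply: glb => a [->|->]; apply/imp_name1P;
    by apply: nn_le; apply/imp_name1P; apply: hl; auto.
(* [nn] is [v1] wherever [l] is not [v0]; there [m] is [v1], hence so is [tri_name m]. *)
apply/imp_name1P; apply: below_nameP => p.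
have [q [i [j [qp li mj]]]] := forces_dec2 l m p.
exists q, i, (tri3 j); split=> //; first exact: tri_nameP.
by have := nm _ _ _ (nnP _ _ li) mj; case: i j {li mj} => [] [].
Qed.

Definition name_alg : H3alg.
Proof.
refine (@MkH3alg name imp_name or_name tri_name one
  _ _ _ _ _ _ tri_name_meet _ _ _ _ _ _ _).
- by move=> x y z; by_values x y z.
- by move=> x y; by_values x y x.
- by move=> x; by_values x x x.
- by move=> x; by_values x x x.
- by move=> x y; by_values x y x.
- by move=> x y; by_values x y x.
- by move=> x y; by_values x y x.
- by move=> x y z; by_values x y z.
- move=> x y /imp_name1P xy /imp_name1P yx; apply: name_eq => p.
  have [q [i [j [qp xi yj]]]] := forces_dec2 x y p; exists q, i; split=> //.
  by rewrite (le3_anti (xy _ _ _ xi yj) (yx _ _ _ yj xi)).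
- by move=> x y z; by_values x y z.
- by move=> x; by_values x x x.
- by move=> x y; by_values x y x.
- by move=> x y; by_values x y x.
Defined.

Lemma ale_nameP (m n : name_alg) : ale m n <-> below (m : name) n.
Proof. exact: imp_name1P. Qed.

(** * Suprema of names and completeness of the algebra *)

Section Sup.
Variable X : name -> Prop.

(** The clause for [vh] excludes [v1] at all refinements; otherwise the value could jump from [vh]
    to [v1] under refinement. *)
Definition sup_forces (p : P) (k : V3) : Prop :=
  match k with
  | v1 => exists2 x : name, X x & x p v1
  | vh => (exists2 x : name, X x & x p vh) /\
          (forall x : name, X x -> forall q, le q p -> ~ x q v1)
  | v0 => forall x : name, X x -> x p v0
  end.

Lemma sup_forces_ub (x : name) p i k :
  X x -> x p i -> sup_forces p k -> le3 i k.
Proof.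
move=> Xx; case: i k => [] [] //= xi.
- by move=> /(_ _ Xx) x0; have := forces_fun xi x0.
- by move=> /(_ _ Xx) x0; have := forces_fun xi x0.
- by move=> [_ /(_ _ Xx _ (le_refl p))].
Qed.

Definition sup_name : name.
Proof.
refine (@dense_name sup_forces _ _ _ _).
- move=> p q [] qp /=.
  + by move=> h x Xx; apply: forces_mono qp (h x Xx).
  + move=> [[x Xx xp] h]; split; first by exists x => //; apply: forces_mono qp xp.
    by move=> y Xy r rq; apply: h => //; apply: le_trans rq qp.
  + by move=> [x Xx xp]; exists x => //; apply: forces_mono qp xp.
- move=> p i j; case: i j => [] [] //=.
  + by move=> h [[x Xx xp] _]; have := forces_fun xp (h x Xx).
  + by move=> h [x Xx xp]; have := forces_fun xp (h x Xx).
  + by move=> [[x Xx xp] _] h; have := forces_fun xp (h x Xx).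
  + by move=> [_ h] [x Xx xp]; case: (h x Xx p (le_refl p)).
  + by move=> [x Xx xp] h; have := forces_fun xp (h x Xx).
  + by move=> [x Xx xp] [_ h]; case: (h x Xx p (le_refl p)).
(* Density: look below [p] for a member valued [v1], then for one valued [vh]; if there is neither,
   regularity forces every member to be [v0] at [p]. *)
- move=> p.
  have [[q [x [qp Xx xq]]]|n1] := pselect (exists q (x : name), [/\ le q p, X x & x q v1]).
    by exists q, v1; split=> //; exists x.
  have [[q [x [qp Xx xq]]]|nh] := pselect (exists q (x : name), [/\ le q p, X x & x q vh]).
    exists q, vh; split=> //; split; first by exists x.
    move=> y Xy r rq yr; apply: n1; exists r, y; split=> //; exact: le_trans rq qp.
  exists p, v0; split=> // x Xx; apply: forces_reg => q qp.
  have [r [k [rq xr]]] := forces_dec x q; exists r => //.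
  have rp := le_trans rq qp.
  case: k xr => // xr; [case: nh | case: n1]; by exists r, x.
(* The witness of a member valued [vh] lies below that member, hence below the supremum. *)
- move=> p [[x Xx /forces_wit [q [g [qp gx gq]]]] _].
  exists q, g; split=> // r i k gi sk.
  have [s [j [sr xj]]] := forces_dec x r.
  apply: le3_trans (gx _ _ _ (gval_mono sr gi) xj) _.
  apply: sup_forces_ub Xx xj _ => /=.
  case: k sk => /=.
  + by move=> h y Xy; apply: forces_mono sr (h y Xy).
  + move=> [[y Xy yp] h]; split; first by exists y => //; apply: forces_mono sr yp.
    by move=> z Xz t ts; apply: h => //; apply: le_trans ts sr.
  + by move=> [y Xy yp]; exists y => //; apply: forces_mono sr yp.
Defined.

Lemma sup_nameP : is_lub (@ale name_alg) X sup_name.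
Proof.
split=> [x Xx|u hu]; apply/ale_nameP => p i j xi uj.
  have [q qp sq] := uj p (le_refl p).
  exact: sup_forces_ub Xx (forces_mono qp xi) sq.
have [q qp] := xi p (le_refl p).
have uq := forces_mono qp uj.
case: i {xi} => /=.
- by [].
- by move=> [[x Xx xq] _]; have /ale_nameP /(_ _ _ _ xq uq) := hu _ Xx.
- by move=> [x Xx xq]; have /ale_nameP /(_ _ _ _ xq uq) := hu _ Xx.
Qed.

End Sup.

(** The infimum is obtained as the supremum of the lower bounds, because a pointwise infimum need
    not satisfy [forces_wit]. *)
Lemma name_alg_complete : complete name_alg.
Proof.
move=> X; split; last by exists (sup_name X); apply: sup_nameP.
pose L (l : name) := forall x : name_alg, X x -> ale (l : name_alg) x.
have [ub lub] := sup_nameP L.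
exists (sup_name L); split=> [x Xx|l hl]; last exact: ub.
by apply: lub => l; apply.
Qed.

End Names.

(** * Propositional completeness *)

Section Propositional.
Variables (Th : signature) (T : formula Th -> Prop).
Hypothesis T_ax : forall a, QH3_axiom a -> T a.
Hypothesis T_mp : forall a b, T a -> T (Imp a b) -> T b.
Hypothesis T_nec : forall a, T a -> T (Tri a).

Definition hom3 (h : formula Th -> V3) : Prop :=
  [/\ forall a b, h (Imp a b) = imp3 (h a) (h b),
      forall a b, h (Or a b) = or3 (h a) (h b),
      forall a, h (Tri a) = tri3 (h a) &
      forall a, T a -> h a = v1].

(** The rules [R3] and [R4] are left out so that hypotheses can be discharged; quantifiers enter
    only through the theorems in [T]. *)
Inductive pder (X : set (formula Th)) : formula Th -> Prop :=
| pder_T a : T a -> pder X a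
| pder_X a : X a -> pder X a
| pder_mp a b : pder X a -> pder X (Imp a b) -> pder X b
| pder_nec a : pder X a -> pder X (Tri a).

Lemma pder_ax X a : QH3_axiom a -> pder X a.
Proof. by move=> /T_ax; apply: pder_T. Qed.

Lemma pder_sub (X Y : set (formula Th)) a : (X `<=` Y)%classic -> pder X a -> pder Y a.
Proof.
move=> XY; elim=> {a} [a Ta|a Xa|a b _ ha _ hab|a _ ha].
- exact: pder_T.
- by apply: pder_X; apply: XY.
- exact: pder_mp ha hab.
- exact: pder_nec.
Qed.

Section Combinators.
Variable X : set (formula Th).
Local Notation D := (pder X).

Lemma pder_K a b : D b -> D (Imp a b).
Proof. by move=> hb; apply: pder_mp hb _; apply/pder_ax/Ax1. Qed.

Lemma pder_S a b c : D (Imp a (Imp b c)) -> D (Imp a b) -> D (Imp a c).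
Proof.
by move=> h1 h2; apply: pder_mp h2 _; apply: pder_mp h1 _; apply/pder_ax/Ax2.
Qed.

Lemma pder_I a : D (Imp a a).
Proof. by apply: (@pder_S _ (Imp a a)); apply/pder_ax/Ax1. Qed.

Lemma pder_trans b a c : D (Imp a b) -> D (Imp b c) -> D (Imp a c).
Proof. by move=> h1 h2; apply: pder_S h1; apply: pder_K. Qed.

Lemma pder_pre a b c : D (Imp b c) -> D (Imp (Imp a b) (Imp a c)).
Proof. by move=> h; apply: pder_mp (pder_K a h) _; apply/pder_ax/Ax2. Qed.

Lemma pder_swap a b c : D (Imp a (Imp b c)) -> D (Imp b (Imp a c)).
Proof.
move=> h; apply: (@pder_trans (Imp a b)); first by apply/pder_ax/Ax1.
by apply: pder_mp h _; apply/pder_ax/Ax2.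
Qed.

Lemma pder_post a b c : D (Imp a b) -> D (Imp (Imp b c) (Imp a c)).
Proof.
move=> h; apply: pder_swap; apply: pder_trans h _.
by apply: pder_swap; apply: pder_I.
Qed.

Lemma pder_dn a b : D (Imp a (Imp (Imp a b) b)).
Proof. by apply: pder_swap; apply: pder_I. Qed.

(** With [c] for the premise, [Tri b] gives [Tri c] by necessitation and [Ax8]; then [Ax9], for
    [Tri a] and [Tri b], reduces [Tri c] to [Imp (Tri a) (Tri c)]. *)
Lemma pder_imp_tri a b :
  D (Imp (Imp (Tri a) (Tri b)) (Tri (Imp (Tri a) (Tri b)))).
Proof.
set c := Imp (Tri a) (Tri b).
have h1 : D (Imp (Tri b) (Tri c)).
  by apply: (@pder_mp _ (Tri (Imp (Tri b) c)));
    [apply: pder_nec; apply/pder_ax/Ax1 | apply/pder_ax/Ax8].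
have h2 : D (Imp (Imp (Tri a) (Tri c)) (Tri c)).
  apply: (@pder_trans (Imp (Imp (Tri b) (Tri (Tri b))) (Imp (Tri a) (Tri c)))).
    exact/pder_ax/Ax1.
  exact/pder_ax/Ax9.
exact: pder_trans (pder_pre _ h1) h2.
Qed.

(** Necessitation applies to hypotheses too, so [a] is discharged in the form [Tri a]; [Ax8] carries
    the necessitation step. *)
Lemma pder_deduction a b :
  pder (a |` X)%classic b -> D (Imp (Tri a) b).
Proof.
elim=> {b} [b Tb|b [->|Xb]|b c _ hb _ hbc|b _ hb].
- by apply: pder_K; apply: pder_T.
- by apply/pder_ax/Ax7.
- by apply: pder_K; apply: pder_X.
- exact: pder_S hbc hb.
- by apply: pder_mp (pder_nec hb) _; apply/pder_ax/Ax8.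
Qed.

End Combinators.

(** A derivation uses finitely many hypotheses, hence a single member of the chain; the alternative
    [set0] covers derivations from theorems alone, in particular for an empty chain. *)
Lemma pder_bigcup (F : set (set (formula Th))) a :
  total_on F subset -> pder (\bigcup_(X in F) X)%classic a ->
  pder set0 a \/ exists2 X, F X & pder X a.
Proof.
move=> Ftot; elim=> {a} [a Ta|a [X FX Xa]|a b _ ha _ hab|a _ ha].
- by left; apply: pder_T.
- by right; exists X => //; apply: pder_X.
- case: ha hab => [ha|[X FX ha]] [hab|[Y FY hab]].
  + by left; apply: pder_mp ha hab.
  + by right; exists Y => //; apply: pder_mp hab; apply: pder_sub ha.
  + by right; exists X => //; apply: pder_mp ha _; apply: pder_sub hab.
  + right; have [XY|YX] := Ftot _ _ FX FY.
      by exists Y => //; apply: pder_mp hab; apply: pder_sub XY ha.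
    by exists X => //; apply: pder_mp ha _; apply: pder_sub YX hab.
- by case: ha => [ha|[X FX ha]]; [left|right; exists X => //]; apply: pder_nec.
Qed.

(** * The valuation of a maximal set not deriving [phi] *)

Section Maximal.
Variables (X : set (formula Th)) (phi : formula Th).
Local Notation D := (pder X).
Hypothesis Dphi : ~ D phi.
Hypothesis Dmax : forall a, ~ D a -> D (Imp (Tri a) phi).

(** Maximality by itself only yields [phi]. Were [Imp (Tri a) (Tri b)] underivable, it would imply
    [phi], as it implies its own [Tri]; [Tri a] implies [phi] too, so [Ax10] would derive [phi]. *)
Lemma max_tri_bot a b : ~ D a -> D (Imp (Tri a) b).
Proof.
move=> na; apply: (@pder_trans _ (Tri b)); last exact/pder_ax/Ax7.
apply: contrapT => nc; apply: Dphi.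
apply: pder_mp (Dmax na) _.
apply: pder_mp (pder_trans (pder_imp_tri _ _ _) (Dmax nc)) _.
exact/pder_ax/Ax10.
Qed.

(** Since [phi] is not derivable, [Tri phi] implies every formula and serves as bottom. *)
Let f := Tri phi.

Lemma max_bot b : D (Imp f b). Proof. exact: max_tri_bot. Qed.

Lemma max_nbot : ~ D f.
Proof. by move=> h; apply: Dphi; apply: pder_mp h _; apply/pder_ax/Ax7. Qed.

(** Negation is implication into [f]. As [Tri b] and [Tri (Imp a b)] act as bottom, [Ax9] says that
    the negation of [b] does not imply the negation of [a]; hence [b] is refuted and [a] is doubly
    negated. This is what keeps the values down to three. *)
Lemma max_imp a b : ~ D b -> ~ D (Imp a b) ->
  D (Imp b f) /\ D (Imp (Imp a f) f).
Proof.
move=> nb nab.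
pose Y := Imp (Imp b (Tri b)) (Imp a (Tri (Imp a b))).
have Yf : D (Imp Y f).
  by apply: pder_trans (max_tri_bot f nab); apply/pder_ax/Ax9.
split.
- apply: (@pder_trans _ (Imp (Imp b f) f)); first exact: pder_dn.
  apply: pder_trans Yf.
  apply: (@pder_trans _ (Imp (Imp b (Tri b)) f)).
    by apply: pder_post; apply: pder_pre; apply: max_tri_bot.
  by apply: pder_pre; apply: max_bot.
- apply: pder_trans Yf.
  apply: (@pder_trans _ (Imp a (Tri (Imp a b)))); last exact/pder_ax/Ax1.
  by apply: pder_pre; apply: max_bot.
Qed.

Definition max_val (a : formula Th) : V3 :=
  if pselect (D a) then v1 else if pselect (D (Imp a f)) then v0 else vh.

Variant max_val_spec a : V3 -> Prop :=
| MaxVal1 of D a : max_val_spec a v1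
| MaxVal0 of ~ D a & D (Imp a f) : max_val_spec a v0
| MaxValh of ~ D a & ~ D (Imp a f) : max_val_spec a vh.

Lemma max_valP a : max_val_spec a (max_val a).
Proof.
rewrite /max_val; case: pselect => h1; first exact: MaxVal1.
by case: pselect => h2; [apply: MaxVal0 | apply: MaxValh].
Qed.

Lemma max_val1 a : max_val a = v1 <-> D a.
Proof. by case: max_valP. Qed.

Lemma max_val0 a : max_val a = v0 <-> D (Imp a f).
Proof.
by case: max_valP => //; split=> // h; case: max_nbot; apply: pder_mp h.
Qed.

Lemma max_valh a : ~ D a -> ~ D (Imp a f) -> max_val a = vh.
Proof. by case: max_valP. Qed.

Lemma max_val_imp a b : max_val (Imp a b) = imp3 (max_val a) (max_val b).
Proof.
case: (max_valP b) => [hb|nb bf|nb nbf].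
- by case: (max_val a); apply/max_val1; apply: pder_K.
- case: (max_valP a) => [ha|na af|na naf] /=.
  + apply/max_val0; apply: (@pder_trans _ b) bf.
    by apply: pder_mp ha _; apply: pder_dn.
  + by apply/max_val1; apply: pder_trans af (max_bot _).
  + apply/max_val0; apply: (@pder_trans _ (Imp a f)); first exact: pder_pre.
    apply: (max_imp nb _).2 => h; apply: naf; exact: pder_trans h bf.
- case: (max_valP a) => [ha|na af|na naf] /=.
  + apply: max_valh => h; first by apply: nb; apply: pder_mp h.
    by apply: nbf; apply: pder_trans h; apply/pder_ax/Ax1.
  + by apply/max_val1; apply: pder_trans af (max_bot _).
  + apply/max_val1; apply: contrapT => nab; exact: nbf (max_imp nb nab).1.
Qed.

Lemma max_val_le a b : le3 (max_val a) (max_val b) <-> D (Imp a b).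
Proof. by rewrite /le3 -max_val_imp max_val1. Qed.

Lemma max_val_hom : hom3 max_val.
Proof.
split; [exact: max_val_imp | | |].
(* The chain is total, so [Ax6] bounds the join by the larger of the two values. *)
- move=> a b; apply: le3_anti.
    have h c : D (Imp a c) -> D (Imp b c) -> D (Imp (Or a b) c).
      move=> ha hb; apply: pder_mp hb _; apply: pder_mp ha _.
      exact/pder_ax/Ax6.
    have [l|l] := le3_total (max_val a) (max_val b).
      have : le3 (max_val (Or a b)) (max_val b).
        by apply/max_val_le/h; [apply/max_val_le | apply: pder_I].
      by move=> l'; apply: le3_trans l' _; case: (max_val a) (max_val b) => [] [].
    have : le3 (max_val (Or a b)) (max_val a).
      by apply/max_val_le/h; [apply: pder_I | apply/max_val_le].
    by move=> l'; apply: le3_trans l' _; case: (max_val a) (max_val b) => [] [].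
  have : le3 (max_val a) (max_val (Or a b)) by apply/max_val_le/pder_ax/Ax4.
  have : le3 (max_val b) (max_val (Or a b)) by apply/max_val_le/pder_ax/Ax5.
  by case: (max_val a) (max_val b) (max_val (Or a b)) => [] [] [].
- move=> a; case: (max_valP a) => [ha|na _|na _] /=.
  + by apply/max_val1; apply: pder_nec.
  + by apply/max_val0; apply: max_tri_bot.
  + by apply/max_val0; apply: max_tri_bot.
- by move=> a Ta; apply/max_val1; apply: pder_T.
Qed.

End Maximal.

(** Otherwise Zorn's lemma gives a set maximal among those not deriving [phi], and its valuation
    does not send [phi] to [v1]. *)
Lemma hom3_complete phi : (forall h, hom3 h -> h phi = v1) -> T phi.
Proof.
move=> hphi; apply: contrapT => nT.
have T0 a : pder set0 a -> T a.
  elim=> {a} // [a b _ ha _ hab|a _ ha]; [exact: T_mp ha hab | exact: T_nec].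
have [|X [nX Xmax]] := @Zorn_bigcup _ (fun X => ~ pder X phi).
  move=> F FP Ftot /(pder_bigcup Ftot) [/T0 //|[X FX hX]].
  exact: FP FX hX.
have Dmax a : ~ pder X a -> pder X (Imp (Tri a) phi).
  move=> na; apply: pder_deduction; apply: contrapT.
  apply: Xmax; split; first by move=> b Xb; right.
  by move=> /(_ a) aX; apply: na; apply: pder_X; apply: aX; left.
have := hphi _ (max_val_hom nX Dmax).
by move/max_val1.
Qed.

End Propositional.

(** * Change of constants and substitution *)

(** Freshness is stated as a property of all large indices, so that finitely many such requirements
    combine. *)
Definition eventually (Q : nat -> Prop) : Prop :=
  exists N, forall n, N <= n -> Q n.

Lemma eventually_and (Q Q' : nat -> Prop) :
  eventually Q -> eventually Q' -> eventually (fun n => Q n /\ Q' n).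
Proof.
move=> [N h] [N' h']; exists (maxn N N') => n.
by rewrite geq_max => /andP [/h ? /h'].
Qed.

Lemma eventually_sub (Q Q' : nat -> Prop) :
  (forall n, Q n -> Q' n) -> eventually Q -> eventually Q'.
Proof. by move=> QQ' [N h]; exists N => n /h /QQ'. Qed.

Lemma eventually_ord k (Q : 'I_k -> nat -> Prop) :
  (forall i, eventually (Q i)) -> eventually (fun n => forall i, Q i n).
Proof.
move=> h; pose N i := sval (cid (h i)).
exists (\max_(i < k) N i) => n le_n i; rewrite /N in le_n.
by apply: (svalP (cid (h i))); apply: leq_trans le_n; apply: (leq_bigmax i).
Qed.

Lemma eventually_neq x : eventually (fun n => n <> x).
Proof. by exists x.+1 => n lt_xn e; rewrite e ltnn in lt_xn. Qed.

Lemma eventually_true Q : (forall n, Q n) -> eventually Q.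
Proof. by move=> h; exists 0. Qed.

Section Syntax.
Variables (F R : Type) (fa : F -> nat) (ra : R -> nat).

Definition Sig (C : Type) : signature := MkSignature C fa ra.

Definition cst (C : Type) (c : C) : term (Sig C) := @Cst (Sig C) c.

Section Subst.
Variable C : Type.
Implicit Types (t u : term (Sig C)) (a b : formula (Sig C)).

Lemma tsubst_id x u t : ~ occurs x t -> tsubst x u t = t.
Proof.
elim: t => [y|c|f ts IH] //=; first by case: eqP => // <-.
move=> h; congr Fun; apply: funext => i; apply: IH => hi; apply: h; by exists i.
Qed.

Lemma fsubst_id x u a : ~ free x a -> fsubst x u a = a.
Proof.
elim: a => [P ts|a IHa b IHb|a IHa b IHb|a IHa|y a IHa|y a IHa] /= h.
- congr Atom; apply: funext => i; apply: tsubst_id => hi; apply: h; by exists i.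
- by rewrite IHa ?IHb //; tauto.
- by rewrite IHa ?IHb //; tauto.
- by rewrite IHa.
- by case: eqP => // yx; rewrite IHa // => ha; apply: h; split=> // /esym.
- by case: eqP => // yx; rewrite IHa // => ha; apply: h; split=> // /esym.
Qed.

Lemma free_for_closed x u a : (forall y, ~ occurs y u) -> free_for x u a.
Proof. by move=> hu; elim: a => //= *; auto. Qed.

Lemma eventually_occurs t : eventually (fun m => ~ occurs m t).
Proof.
elim: t => [y|c|f ts IH] /=; [exact: eventually_neq | by apply: eventually_true => n [] |].
by apply: eventually_sub (eventually_ord IH) => n h [i /h].
Qed.

Lemma eventually_free a : eventually (fun m => ~ free m a).
Proof.
elim: a => [P ts|a IHa b IHb|a IHa b IHb|a IHa|y a IHa|y a IHa] //=.
- apply: eventually_sub (eventually_ord (fun i => eventually_occurs (ts i))).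
  by move=> n h [i /h].
- by apply: eventually_sub (eventually_and IHa IHb) => n; tauto.
- by apply: eventually_sub (eventually_and IHa IHb) => n; tauto.
- by apply: eventually_sub IHa => n; tauto.
- by apply: eventually_sub IHa => n; tauto.
Qed.

Lemma tsubst_back x t :
  eventually (fun m => tsubst m (Var x) (tsubst x (Var m) t) = t).
Proof.
elim: t => [y|c|f ts IH] /=; [| by apply: eventually_true |].
- apply: eventually_sub (eventually_neq y) => m my.
  by case: (eqVneq y x) => [->|_] /=; [rewrite eqxx | case: eqP => // /esym].
- apply: eventually_sub (eventually_ord IH) => m h.
  by congr Fun; apply: funext.
Qed.

(** A large [m] does not occur in [a], so each of its free occurrences stems from a free [x]; none
    lies under a quantifier on [x], and [x] can be put back without capture. *)
Lemma fsubst_back x a :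
  eventually (fun m => free_for m (Var x) (fsubst x (Var m) a) /\
                       fsubst m (Var x) (fsubst x (Var m) a) = a).
Proof.
have quant y b : eventually (fun m => free_for m (Var x) (fsubst x (Var m) b) /\
       fsubst m (Var x) (fsubst x (Var m) b) = b) ->
    eventually (fun m => [/\ m <> y, ~ free m b,
      free_for m (Var x) (fsubst x (Var m) b) &
      fsubst m (Var x) (fsubst x (Var m) b) = b]).
  move=> h; apply: eventually_sub (eventually_and h
    (eventually_and (eventually_neq y) (eventually_free b))) => m [[? ?] [? ?]]; by split.
elim: a => [P ts|a IHa b IHb|a IHa b IHb|a IHa|y a IHa|y a IHa] /=.
- apply: eventually_sub (eventually_ord (fun i => tsubst_back x (ts i))) => m h.
  by split=> //; congr Atom; apply: funext.
- apply: eventually_sub (eventually_and IHa IHb) => m [[? ->] [? ->]] //.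
- apply: eventually_sub (eventually_and IHa IHb) => m [[? ->] [? ->]] //.
- by apply: eventually_sub IHa => m [? ->].
- apply: eventually_sub (quant y _ IHa) => m [my nfree hfor e].
  case: (eqVneq y x) => [yx|yx] /=; case: eqP => [/esym //|_].
    by split; [left; tauto | rewrite fsubst_id].
  by split; [right; split=> //; apply/eqP | rewrite e].
- apply: eventually_sub (quant y _ IHa) => m [my nfree hfor e].
  case: (eqVneq y x) => [yx|yx] /=; case: eqP => [/esym //|_].
    by split; [left; tauto | rewrite fsubst_id].
  by split; [right; split=> //; apply/eqP | rewrite e].
Qed.

Lemma derivable_K (G : formula (Sig C) -> Prop) a b :
  derivable G b -> derivable G (Imp a b).
Proof. by move=> hb; apply: MP hb _; apply/Axm/Ax1. Qed.

Lemma derivable_fsubst (G : formula (Sig C) -> Prop) x u a :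
  free_for x u a -> derivable G a -> derivable G (fsubst x u a).
Proof.
move=> hfor ha; apply: MP (Axm _ (Ax12 hfor)).
(* A theorem without free [x], taken as premise, turns [R4] into generalisation. *)
have hb : derivable G (Imp (All x a) (Imp (All x a) (All x a))).
  exact/Axm/Ax1.
by apply: MP hb _; apply: R4; [move=> /=; tauto | apply: derivable_K].
Qed.

End Subst.

Definition upd (D : Type) (s : nat -> D) (x : nat) (d : D) : nat -> D :=
  fun y => if y == x then d else s y.

Lemma upd_id (Th : signature) y : upd (@Var Th) y (Var y) = Var.
Proof. by apply: funext => z; rewrite /upd; case: eqP => [->|]. Qed.

(** * Simultaneous replacement of constants and free variables *)

Section Map.
Variables (C1 C2 : Type).
Implicit Types (sg : C1 -> term (Sig C2)) (s : nat -> term (Sig C2)).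
Implicit Types (t : term (Sig C1)) (a b : formula (Sig C1)).

Fixpoint tmap sg s t : term (Sig C2) :=
  match t with
  | Var x => s x
  | Cst c => sg c
  | Fun f ts => @Fun (Sig C2) f (fun i => tmap sg s (ts i))
  end.

(** Bound variables keep their names and are shielded from [s] by [upd]; capture is excluded by
    freshness hypotheses on [sg] and [s] where it matters. *)
Fixpoint fmap sg s a : formula (Sig C2) :=
  match a with
  | Atom P ts => @Atom (Sig C2) P (fun i => tmap sg s (ts i))
  | Imp b c => Imp (fmap sg s b) (fmap sg s c)
  | Or b c => Or (fmap sg s b) (fmap sg s c)
  | Tri b => Tri (fmap sg s b)
  | All y b => All y (fmap sg (upd s y (Var y)) b)
  | Ex y b => Ex y (fmap sg (upd s y (Var y)) b)
  end.

Lemma eq_tmap sg s s' t :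
  (forall x, occurs x t -> s x = s' x) -> tmap sg s t = tmap sg s' t.
Proof.
elim: t => [x|c|f ts IH] //= h; first exact: h.
congr Fun; apply: funext => i; apply: IH => x hx; apply: h; by exists i.
Qed.

Lemma eq_fmap sg s s' a :
  (forall x, free x a -> s x = s' x) -> fmap sg s a = fmap sg s' a.
Proof.
elim: a s s' => [P ts|a IHa b IHb|a IHa b IHb|a IHa|y a IHa|y a IHa] s s' /= h.
- congr Atom; apply: funext => i; apply: eq_tmap => x hx; apply: h; by exists i.
- by rewrite (IHa s s') ?(IHb s s') //; auto.
- by rewrite (IHa s s') ?(IHb s s') //; auto.
- by rewrite (IHa s s').
- congr All; apply: IHa => x hx; rewrite /upd; case: eqP => // xy; exact: h.
- congr Ex; apply: IHa => x hx; rewrite /upd; case: eqP => // xy; exact: h.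
Qed.

Lemma occurs_tmap sg s t x : (forall c, ~ occurs x (sg c)) ->
  occurs x (tmap sg s t) -> exists2 y, occurs y t & occurs x (s y).
Proof.
move=> hsg; elim: t => [y|c|f ts IH] /=; first by exists y.
  by move/hsg.
by move=> [i /IH [y hy ?]]; exists y => //; exists i.
Qed.

Lemma free_fmap sg s a x : (forall c, ~ occurs x (sg c)) ->
  free x (fmap sg s a) -> exists2 y, free y a & occurs x (s y).
Proof.
move=> hsg.
elim: a s => [P ts|a IHa b IHb|a IHa b IHb|a IHa|y a IHa|y a IHa] s /=.
- by move=> [i /(occurs_tmap hsg) [y hy ?]]; exists y => //; exists i.
- by move=> [/IHa|/IHb] [y ? ?]; exists y; auto.
- by move=> [/IHa|/IHb] [y ? ?]; exists y; auto.
- exact: IHa.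
- by move=> [xy /IHa [z hz]]; rewrite /upd; case: eqP => [_ /= //|]; exists z.
- by move=> [xy /IHa [z hz]]; rewrite /upd; case: eqP => [_ /= //|]; exists z.
Qed.

Lemma tsubst_tmap sg s x d t : (forall c, ~ occurs x (sg c)) ->
  s x = Var x -> (forall y, y <> x -> ~ occurs x (s y)) ->
  tsubst x d (tmap sg s t) = tmap sg (upd s x d) t.
Proof.
move=> hsg sx hs; elim: t => [y|c|f ts IH] /=.
- by rewrite /upd; case: eqP => [->|/hs ?]; [rewrite sx /= eqxx | rewrite tsubst_id].
- exact: tsubst_id.
- by congr Fun; apply: funext.
Qed.

Lemma fsubst_fmap sg s x d a : (forall c, ~ occurs x (sg c)) ->
  s x = Var x -> (forall y, y <> x -> ~ occurs x (s y)) ->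
  fsubst x d (fmap sg s a) = fmap sg (upd s x d) a.
Proof.
move=> hsg.
elim: a s => [P ts|a IHa b IHb|a IHa b IHb|a IHa|y a IHa|y a IHa] s sx hs /=.
- by congr Atom; apply: funext => i; apply: tsubst_tmap.
- by rewrite IHa // IHb.
- by rewrite IHa // IHb.
- by rewrite IHa.
- case: eqP => [->|yx].
    congr All; apply: eq_fmap => z _; rewrite /upd; by case: eqP.
  rewrite IHa; last 2 first.
  + by rewrite /upd; case: eqP => // /esym.
  + by move=> z zx; rewrite /upd; case: eqP => [_ /= /esym //|_]; apply: hs.
  congr All; apply: eq_fmap => z _; rewrite /upd.
  by case: eqP => // zx; case: eqP => // zy; case: yx; rewrite -zy.
- case: eqP => [->|yx].
    congr Ex; apply: eq_fmap => z _; rewrite /upd; by case: eqP.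
  rewrite IHa; last 2 first.
  + by rewrite /upd; case: eqP => // /esym.
  + by move=> z zx; rewrite /upd; case: eqP => [_ /= /esym //|_]; apply: hs.
  congr Ex; apply: eq_fmap => z _; rewrite /upd.
  by case: eqP => // zx; case: eqP => // zy; case: yx; rewrite -zy.
Qed.

(** A finite derivation involves finitely many variables; terms whose variables all start at a large
    [N] can replace constants in it without capture. *)
Definition vars_from N sg : Prop := forall c x, occurs x (sg c) -> N <= x.

Lemma vars_from_notin N sg x : vars_from N sg -> x < N -> forall c, ~ occurs x (sg c).
Proof. by move=> h xN c /h; rewrite leqNgt xN. Qed.

Lemma vars_from_le M N sg : M <= N -> vars_from N sg -> vars_from M sg.
Proof. by move=> MN h c x /h; apply: leq_trans. Qed.

Lemma occurs_tmapV sg t x : (forall c, ~ occurs x (sg c)) ->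
  occurs x (tmap sg Var t) -> occurs x t.
Proof. by move=> h /(occurs_tmap h) [y hy /= ->]. Qed.

Lemma free_fmapV sg a x : (forall c, ~ occurs x (sg c)) ->
  free x (fmap sg Var a) -> free x a.
Proof. by move=> h /(free_fmap h) [y hy /= ->]. Qed.

Lemma tmap_tsubst sg x u t : (forall c, ~ occurs x (sg c)) ->
  tmap sg Var (tsubst x u t) = tsubst x (tmap sg Var u) (tmap sg Var t).
Proof.
move=> hsg; elim: t => [y|c|f ts IH] /=.
- by case: eqP.
- by rewrite tsubst_id.
- by congr Fun; apply: funext.
Qed.

Lemma fmap_fsubst sg x u a : (forall c, ~ occurs x (sg c)) ->
  fmap sg Var (fsubst x u a) = fsubst x (tmap sg Var u) (fmap sg Var a).
Proof.
move=> hsg; elim: a => [P ts|a IHa b IHb|a IHa b IHb|a IHa|y a IHa|y a IHa] /=.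
- by congr Atom; apply: funext => i; apply: tmap_tsubst.
- by rewrite IHa IHb.
- by rewrite IHa IHb.
- by rewrite IHa.
- by case: eqP => _ /=; rewrite upd_id ?IHa.
- by case: eqP => _ /=; rewrite upd_id ?IHa.
Qed.

Lemma free_for_fmap x u a : free_for x u a ->
  exists N, forall sg, vars_from N sg ->
    free_for x (tmap sg Var u) (fmap sg Var a).
Proof.
have notin z N sg : vars_from (maxn z.+1 N) sg ->
    (forall c, ~ occurs z (sg c)) /\ vars_from N sg.
  move=> h; split; first by apply: vars_from_notin h _; rewrite leq_max leqnn.
  by apply: vars_from_le h; rewrite leq_max leqnn orbT.
have bin b c : 
  (free_for x u b -> exists N, forall sg, vars_from N sg ->
    free_for x (tmap sg Var u) (fmap sg Var b)) ->
  (free_for x u c -> exists N, forall sg, vars_from N sg ->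
    free_for x (tmap sg Var u) (fmap sg Var c)) ->
  free_for x u b /\ free_for x u c -> exists N, forall sg, vars_from N sg ->
    free_for x (tmap sg Var u) (fmap sg Var b) /\
    free_for x (tmap sg Var u) (fmap sg Var c).
  move=> hb hc [/hb [N h] /hc [M h']]; exists (maxn N M) => sg hsg.
  split; [apply: h | apply: h'];
    by apply: vars_from_le hsg; rewrite leq_max leqnn ?orbT.
have quant y b :
  (free_for x u b -> exists N, forall sg, vars_from N sg ->
    free_for x (tmap sg Var u) (fmap sg Var b)) ->
  ~ (x <> y /\ free x b) \/ ~ occurs y u /\ free_for x u b ->
  exists N, forall sg, vars_from N sg ->
  ~ (x <> y /\ free x (fmap sg (upd Var y (Var y)) b)) \/
  ~ occurs y (tmap sg Var u) /\
    free_for x (tmap sg Var u) (fmap sg (upd Var y (Var y)) b).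
  move=> hb [nf|[no /hb [N h]]].
    exists (maxn x.+1 0) => sg /notin [hx _]; left; rewrite upd_id.
    by move=> [xy /(free_fmapV hx)]; tauto.
  exists (maxn y.+1 N) => sg /notin [hy hN]; right; rewrite upd_id.
  by split; [move/(occurs_tmapV hy) | apply: h].
elim: a => [P ts|a IHa b IHb|a IHa b IHb|a IHa|y a IHa|y a IHa] /=.
- by exists 0.
- exact: bin.
- exact: bin.
- exact: IHa.
- exact: quant.
- exact: quant.
Qed.

Lemma axiom_fmap a : QH3_axiom a ->
  exists N, forall sg, vars_from N sg -> QH3_axiom (fmap sg Var a).
Proof.
case=> {a} [a b|a b c|a b c|a b|a b|a b c|a|a b|a b|a b c|x u a ha|x u a ha|x a|x a|x a|x a];
  try (exists 0 => sg _ /=; rewrite ?upd_id; by constructor).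
- have [N h] := free_for_fmap ha; exists (maxn x.+1 N) => sg hsg /=.
  rewrite upd_id fmap_fsubst.
    by apply: Ax11; apply: h; apply: vars_from_le hsg; rewrite leq_max leqnn orbT.
  by apply: vars_from_notin hsg _; rewrite leq_max leqnn.
- have [N h] := free_for_fmap ha; exists (maxn x.+1 N) => sg hsg /=.
  rewrite upd_id fmap_fsubst.
    by apply: Ax12; apply: h; apply: vars_from_le hsg; rewrite leq_max leqnn orbT.
  by apply: vars_from_notin hsg _; rewrite leq_max leqnn.
Qed.

(** The bound comes from the uses of [Ax11], [Ax12], [R3] and [R4] in the derivation, so one [N]
    serves all [sg] and [G2]. *)
Lemma derivable_fmap (G1 : formula (Sig C1) -> Prop) a : derivable G1 a ->
  exists N, forall sg (G2 : formula (Sig C2) -> Prop), vars_from N sg ->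
    (forall g, G1 g -> G2 (fmap sg Var g)) -> derivable G2 (fmap sg Var a).
Proof.
elim=> {a} [a Ga|a /axiom_fmap [N h]|a b _ [N ha] _ [M hab]|a _ [N ha]|
            x a b nx _ [N h]|x a b nx _ [N h]].
- by exists 0 => sg G2 _ hG; apply/Hyp/hG.
- by exists N => sg G2 hsg _; apply/Axm/h.
- exists (maxn N M) => sg G2 hsg hG.
  apply: MP (ha _ _ _ hG) (hab _ _ _ hG);
    by apply: vars_from_le hsg; rewrite leq_max leqnn ?orbT.
- by exists N => sg G2 hsg hG; apply/Nec/ha.
- exists (maxn x.+1 N) => sg G2 hsg hG /=; rewrite upd_id; apply: R3.
    by apply: contra_not nx; apply: free_fmapV; apply: vars_from_notin hsg _;
      rewrite leq_max leqnn.
  by apply: h => //; apply: vars_from_le hsg; rewrite leq_max leqnn orbT.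
- exists (maxn x.+1 N) => sg G2 hsg hG /=; rewrite upd_id; apply: R4.
    by apply: contra_not nx; apply: free_fmapV; apply: vars_from_notin hsg _;
      rewrite leq_max leqnn.
  by apply: h => //; apply: vars_from_le hsg; rewrite leq_max leqnn orbT.
Qed.

End Map.

Lemma fmap_id C (a : formula (Sig C)) : fmap Cst Var a = a.
Proof.
have tid (t : term (Sig C)) : tmap Cst Var t = t.
  by elim: t => //= f ts IH; congr Fun; apply: funext.
by elim: a => //= [P ts|a -> b ->|a -> b ->|a ->|y a IH|y a IH] //;
  rewrite ?upd_id ?IH //; congr Atom; apply: funext.
Qed.

Lemma fmap_comp C1 C2 C3 (sg : C1 -> term (Sig C2)) (sg' : C2 -> term (Sig C3)) a :
  fmap sg' Var (fmap sg Var a) = fmap (fun c => tmap sg' Var (sg c)) Var a.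
Proof.
have tc t : tmap sg' Var (tmap sg Var t) = tmap (fun c => tmap sg' Var (sg c)) Var t.
  by elim: t => //= f ts IH; congr Fun; apply: funext.
by elim: a => //= [P ts|a -> b ->|a -> b ->|a ->|y a IH|y a IH] //;
  rewrite ?upd_id ?IH //; congr Atom; apply: funext.
Qed.

(** * Extension of the signature by countably many constants *)

Section Extension.
Variable C : Type.
Local Notation Th := (Sig C).
Local Notation Th' := (Sig (C + nat)).

Definition emb (a : formula Th) : formula Th' := fmap (fun c => cst (inl c)) Var a.

Definition embG (G : formula Th -> Prop) (a : formula Th') : Prop :=
  exists2 g, G g & a = emb g.

(** All new constants are sent to one variable past the bound of the derivation; this map undoes
    [emb]. *)
Lemma derivable_emb G a : derivable (embG G) (emb a) -> derivable G a.
Proof.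
move=> /(derivable_fmap C) [N h].
pose sg (c : C + nat) : term Th := if c is inl c then cst c else Var N.
have sgK g : fmap sg Var (emb g) = g by rewrite /emb fmap_comp fmap_id.
rewrite -[a]sgK; apply: h => [[c|n] x //= -> //|_ [g Gg ->]].
by rewrite sgK.
Qed.

Definition csub n (u : term Th') (c : C + nat) : term Th' :=
  if c is inr k then if k == n then u else cst (inr k) else cst c.

Lemma tmap_csub t : eventually (fun n => forall u, tmap (csub n u) Var t = t).
Proof.
elim: t => [x|[c|k]|f ts IH] /=; try (by apply: eventually_true).
- apply: eventually_sub (eventually_neq k) => n nk u.
  by case: eqP => // /esym.
- by apply: eventually_sub (eventually_ord IH) => n h u; congr Fun; apply: funext.
Qed.

Lemma fmap_csub a : eventually (fun n => forall u, fmap (csub n u) Var a = a).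
Proof.
elim: a => [P ts|a IHa b IHb|a IHa b IHb|a IHa|y a IHa|y a IHa] /=.
- apply: eventually_sub (eventually_ord (fun i => tmap_csub (ts i))) => n h u.
  by congr Atom; apply: funext.
- by apply: eventually_sub (eventually_and IHa IHb) => n [h h'] u; rewrite h h'.
- by apply: eventually_sub (eventually_and IHa IHb) => n [h h'] u; rewrite h h'.
- by apply: eventually_sub IHa => n h u; rewrite h.
- by apply: eventually_sub IHa => n h u; rewrite upd_id h.
- by apply: eventually_sub IHa => n h u; rewrite upd_id h.
Qed.

(** For large [n] the constant [inr n] is absent from [a], and it never occurs in [embG G]. It is
    replaced throughout the derivation by a fresh variable [m], which is then renamed to [x]. *)
Lemma derivable_gen_cst G x a :
  eventually (fun n =>
    derivable (embG G) (fsubst x (cst (inr n)) a) -> derivable (embG G) a).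
Proof.
apply: eventually_sub (fmap_csub a) => n fresh.
move=> /(derivable_fmap (C + nat)) [N h].
have [M hM] := eventually_and (fsubst_back x a) (eventually_neq x).
(* Passing [N] makes the replacement preserve the derivation; passing [M] allows renaming back to
   [x]. *)
pose m := maxn N M; have [[hfor e] mx] := hM m (leq_maxr _ _).
have hsg : vars_from N (csub n (Var m)).
  by move=> [c|k] y //=; case: eqP => //= _ ->; apply: leq_maxl.
have {}h : derivable (embG G) (fsubst x (Var m) a).
  have <- : fmap (csub n (Var m)) Var (fsubst x (cst (inr n)) a)
          = fsubst x (Var m) a.
    rewrite fmap_fsubst ?fresh /= ?eqxx //.
    by move=> [c|k] /=; [| case: eqP => //= _ xm; case: mx].
  apply: h => // _ [g Gg ->]; exists g => //.
  by rewrite /emb fmap_comp.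
by rewrite -e; apply: derivable_fsubst.
Qed.

End Extension.
End Syntax.

(** * The term model *)

Lemma ale_anti (A : H3alg) (x y : A) : ale x y -> ale y x -> x = y.
Proof. exact: aimp_anti. Qed.

Lemma ainfE (A : H3alg) (X : A -> Prop) m : is_glb (@ale A) X m -> ainf X = m.
Proof.
move=> [lb glb]; have [lb' glb'] : is_glb (@ale A) X (ainf X).
  by apply: epsilon_spec; exists m.
by apply: ale_anti; [apply: glb | apply: glb'].
Qed.

Lemma asupE (A : H3alg) (X : A -> Prop) m : is_lub (@ale A) X m -> asup X = m.
Proof.
move=> [ub lub]; have [ub' lub'] : is_lub (@ale A) X (asup X).
  by apply: epsilon_spec; exists m.
by apply: ale_anti; [apply: lub' | apply: lub].
Qed.

Section Canonical.
Variables (F R : Type) (fa : F -> nat) (ra : R -> nat) (C : Type).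
Local Notation Th := (Sig fa ra C).
Local Notation Th' := (Sig fa ra (C + nat)).
Variable G : formula Th -> Prop.
Local Notation T := (derivable (embG G)).
Local Notation hom := (hom3 T).

Lemma theory_complete a : (forall h, hom h -> h a = v1) -> T a.
Proof.
apply: hom3_complete => [b|b c|b]; [exact: Axm | exact: MP | exact: Nec].
Qed.

Lemma hom_imp_le h a b : hom h -> T (Imp a b) -> le3 (h a) (h b).
Proof. by case=> hI _ _ hT /hT; rewrite hI. Qed.

Definition closed (d : term Th') : Prop := forall x, ~ occurs x d.

(** A single closed term is enough: a new constant fresh for [a]. *)
Lemma theory_gen x a :
  (forall d, closed d -> T (fsubst x d a)) -> T a.
Proof.
by move=> h; have [n /(_ n (leqnn n))] := derivable_gen_cst G x a; apply; apply: h => y [].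
Qed.

Lemma theory_ex x a b : ~ free x b ->
  (forall d, closed d -> T (Imp (fsubst x d a) b)) -> T (Imp (Ex x a) b).
Proof.
move=> nx h; apply: R3 => //; apply: (@theory_gen x) => d cd /=.
by rewrite (fsubst_id _ nx); apply: h.
Qed.

Lemma theory_all x a b : ~ free x b ->
  (forall d, closed d -> T (Imp b (fsubst x d a))) -> T (Imp b (All x a)).
Proof.
move=> nx h; apply: R4 => //; apply: (@theory_gen x) => d cd /=.
by rewrite (fsubst_id _ nx); apply: h.
Qed.

(** * Forcing conditions and the names of sentences *)

Fixpoint sat (h : formula Th' -> V3) (l : seq (formula Th' * V3)) : Prop :=
  if l is (a, k) :: l' then h a = k /\ sat h l' else True.

Fixpoint closed_list (l : seq (formula Th' * V3)) : Prop :=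
  if l is (a, _) :: l' then sentence a /\ closed_list l' else True.

(** Where [b] is [v0], this formula is two-valued: [v0] if [a] has the value [k], and [v1]
    otherwise. *)
Definition neq_val (b a : formula Th') (k : V3) : formula Th' :=
  match k with
  | v0 => Imp (Imp a b) b
  | vh => Or (Tri a) (Imp a b)
  | v1 => Imp (Tri a) b
  end.

(* The complement of the condition [l]; the language has no bottom, so [b]
   plays its role wherever it takes the value [v0]. *)
Fixpoint unsat (b : formula Th') (l : seq (formula Th' * V3)) : formula Th' :=
  if l is (a, k) :: l' then Or (neq_val b a k) (unsat b l') else b.

Lemma unsat_sentence b l : sentence b -> closed_list l -> sentence (unsat b l).
Proof.
move=> sb; elim: l => [|[a k] l IH] //= [sa sl] x /= [|]; last exact: IH.
by have := sa x; have := sb x; case: k => /=; tauto.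
Qed.

Lemma unsat_v0 h b l : hom h -> h b = v0 -> sat h l -> h (unsat b l) = v0.
Proof.
move=> [hI hO hT _] hb; elim: l => [|[a k] l IH] //= [ha sl].
by rewrite hO IH //; case: k ha => ha /=; rewrite ?(hO, hI, hT) hb ha.
Qed.

Lemma unsat_nsat h b l : hom h -> h b = v0 -> ~ sat h l -> h (unsat b l) = v1.
Proof.
move=> hh hb; have [hI hO hT _] := hh; elim: l => [|[a k] l IH] //= ns.
rewrite hO; have [sl|nl] := pselect (sat h l); last first.
  by rewrite (IH nl); case: (h _).
rewrite (unsat_v0 hh hb sl).
have : h a <> k by move=> ha; apply: ns.
by case: k {ns} => /=; rewrite ?(hO, hI, hT) hb; case: (h a).
Qed.

Record cond := MkCond {
  clist :> seq (formula Th' * V3);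
  clist_closed : closed_list clist;
  clist_sat : exists2 h, hom h & sat h clist
}.

Definition cle (q p : cond) : Prop := forall h, hom h -> sat h q -> sat h p.

Lemma cle_refl p : cle p p. Proof. by []. Qed.

Lemma cle_trans p q r : cle p q -> cle q r -> cle p r.
Proof. by move=> pq qr h hh /(pq h hh) /(qr h hh). Qed.

(** Any valuation satisfying [p] can be followed into a refinement recording its value at [a]; the
    density arguments below rest on this. *)
Lemma cond_cons a h (p : cond) : sentence a -> hom h -> sat h p ->
  exists q : cond, [/\ cle q p, sat h q & forall h', sat h' q -> h' a = h a].
Proof.
move=> sa hh sp.
have cl : closed_list ((a, h a) :: p) by split=> //; apply: clist_closed.
have st : exists2 h', hom h' & sat h' ((a, h a) :: p) by exists h.
by exists (MkCond cl st); split=> // [h' _|h'] [].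
Qed.

Definition sent := {a : formula Th' | sentence a}.

Definition gforces (g : sent) (p : cond) (k : V3) : Prop :=
  forall h, hom h -> sat h p -> h (sval g) = k.

Lemma gforces_mono g p q k : cle q p -> gforces g p k -> gforces g q k.
Proof. by move=> qp gk h hh /(qp h hh); apply: gk. Qed.

Definition sent_name (g : sent) : name cle gforces.
Proof.
exists (gforces g).
- exact: gforces_mono.
(* If [h] took another value at [g], the refinement of [p] recording that value would have no
   refinement forcing [k]. *)
- move=> p k hk h hh sp.
  have [q [qp sq qg]] := cond_cons (svalP g) hh sp.
  have [r rq gr] := hk q qp.
  have [h' hh' sr] := clist_sat r.
  by rewrite -(qg h' (rq _ hh' sr)); apply: gr.
- move=> p i j gi gj; have [h hh sp] := clist_sat p.
  by rewrite -(gi h hh sp); apply: gj.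
- move=> p; have [h hh sp] := clist_sat p.
  have [q [qp sq qg]] := cond_cons (svalP g) hh sp.
  by exists q, (h (sval g)); split=> // h' _; apply: qg.
(* A sentence is its own witness. *)
- move=> p gp; exists p, g; split=> // q i j gi gj.
  have [h hh sq] := clist_sat q.
  by rewrite -(gi h hh sq) -(gj h hh sq); case: (h _).
Defined.

Definition Alg : H3alg := name_alg cle_refl cle_trans gforces_mono.

(** [aone] is a default value for formulas with free variables. *)
Definition fname (a : formula Th') : Alg :=
  if pselect (sentence a) is left sa then sent_name (exist _ a sa) else aone Alg.

Lemma fnameE a (sa : sentence a) : fname a = sent_name (exist _ a sa).
Proof.
by rewrite /fname; case: pselect => // sa'; rewrite (Prop_irrelevance sa sa').
Qed.

Lemma fname_le a b : sentence a -> sentence b ->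
  ale (fname a) (fname b) <-> forall h, hom h -> le3 (h a) (h b).
Proof.
move=> sa sb; rewrite (fnameE sa) (fnameE sb); split.
  move=> /ale_nameP ab h hh.
  (* The condition recording both values of [h] decides both names, so the comparison holds at
     [h]. *)
  have cl : closed_list [:: (a, h a); (b, h b)] by [].
  have st : exists2 h', hom h' & sat h' [:: (a, h a); (b, h b)] by exists h.
  by apply: (ab (MkCond cl st)) => h' _ [? []].
move=> ab; apply/ale_nameP => p i j ai bj; have [h hh sp] := clist_sat p.
by rewrite -(ai h hh sp) -(bj h hh sp); apply: ab.
Qed.

Lemma fname_v1 a : sentence a -> fname a = aone Alg <-> forall h, hom h -> h a = v1.
Proof.
move=> sa; rewrite (fnameE sa); split=> [e h hh|ha].
  have cl : closed_list [:: (a, h a)] by [].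
  have st : exists2 h', hom h' & sat h' [:: (a, h a)] by exists h.
  have : sent_name (exist _ a sa) (MkCond cl st) (h a) by move=> h' _ [].
  rewrite e => h1; exact: forces_fun h1 (@const_nameP _ _ _ _ _ _ _ true _).
apply: (name_eq cle_trans) => p; exists p, v1; split=> //.
  by move=> h hh _; apply: ha.
exact: (@const_nameP _ _ _ _ _ _ _ true).
Qed.

Lemma cond_decide a b (p : cond) : sentence a -> sentence b ->
  exists (q : cond) i j, [/\ cle q p,
    forall h, sat h q -> h a = i & forall h, sat h q -> h b = j].
Proof.
move=> sa sb; have [h hh sp] := clist_sat p.
have cl : closed_list ((a, h a) :: (b, h b) :: p).
  by do 2!split=> //; apply: clist_closed.
have st : exists2 h', hom h' & sat h' ((a, h a) :: (b, h b) :: p) by exists h.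
exists (MkCond cl st), (h a), (h b).
by split=> [h' _|h'|h'] [? []].
Qed.

Lemma fname_imp a b : sentence a -> sentence b ->
  fname (Imp a b) = aimp (fname a) (fname b).
Proof.
move=> sa sb; have sab : sentence (Imp a b) by move=> x [/sa|/sb].
rewrite (fnameE sa) (fnameE sb) (fnameE sab).
apply: (name_eq cle_trans) => p.
have [q [i [j [qp ha hb]]]] := cond_decide p sa sb; exists q, (imp3 i j).
split=> //; first by move=> h [hI _ _ _] sq; rewrite /= hI ha ?hb.
by apply: imp_nameP => h _ sq; [apply: ha | apply: hb].
Qed.

Lemma fname_or a b : sentence a -> sentence b ->
  fname (Or a b) = ajoin (fname a) (fname b).
Proof.
move=> sa sb; have sab : sentence (Or a b) by move=> x [/sa|/sb].
rewrite (fnameE sa) (fnameE sb) (fnameE sab).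
apply: (name_eq cle_trans) => p.
have [q [i [j [qp ha hb]]]] := cond_decide p sa sb; exists q, (or3 i j).
split=> //; first by move=> h [_ hO _ _] sq; rewrite /= hO ha ?hb.
by apply: or_nameP => h _ sq; [apply: ha | apply: hb].
Qed.

Lemma fname_tri a : sentence a -> fname (Tri a) = atri (fname a).
Proof.
move=> sa; have sta : sentence (Tri a) by [].
rewrite (fnameE sa) (fnameE sta).
apply: (name_eq cle_trans) => p.
have [q [i [_ [qp ha _]]]] := cond_decide p sa sa; exists q, (tri3 i).
split=> //; first by move=> h [_ _ hT _] sq; rewrite /= hT ha.
by apply: tri_nameP => h _ sq; apply: ha.
Qed.

(** * Quantified sentences as bounds of their closed instances *)

Section Quantifiers.
Variables (x : nat) (a : formula Th').
Hypothesis a_closed : forall y, y <> x -> ~ free y a.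

Let sE : sentence (Ex x a).
Proof. by move=> y /= [yx]; apply: a_closed. Qed.

Let sA : sentence (All x a).
Proof. by move=> y /= [yx]; apply: a_closed. Qed.

Definition instances (m : Alg) : Prop :=
  exists2 d, closed d & m = fname (fsubst x d a).

Hypothesis inst_sentence : forall d, closed d -> sentence (fsubst x d a).

Lemma hom_inst_ex h d : hom h -> closed d -> le3 (h (fsubst x d a)) (h (Ex x a)).
Proof.
by move=> hh cd; apply: hom_imp_le hh _; apply/Axm/Ax11/free_for_closed.
Qed.

Lemma hom_inst_all h d : hom h -> closed d -> le3 (h (All x a)) (h (fsubst x d a)).
Proof.
by move=> hh cd; apply: hom_imp_le hh _; apply/Axm/Ax12/free_for_closed.
Qed.

(** If an upper bound failed at [p], some sentence [th] would dominate all instances, hence [Ex x a]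
    by [R3], while its value on a refinement [q] stays at most [j]. *)
Lemma fname_ex : is_lub (@ale Alg) instances (fname (Ex x a)).
Proof.
split=> [_ [d cd ->]|u ub].
  by apply/(fname_le (inst_sentence cd) sE) => h hh; apply: hom_inst_ex.
rewrite (fnameE sE); apply/ale_nameP => p k j ek uj.
have le_j d h : closed d -> hom h -> sat h p -> le3 (h (fsubst x d a)) j.
  move=> cd hh sp.
  have [q [qp sq qd]] := cond_cons (inst_sentence cd) hh sp.
  have := ub _ (ex_intro2 _ _ d cd erefl).
  rewrite (fnameE (inst_sentence cd)) => /ale_nameP; apply.
    by move=> h' _; apply: qd.
  exact: forces_mono qp uj.
apply: contrapT => nkj.
have nj1 : j <> v1 by move=> ej; apply: nkj; rewrite ej; case: (k).
(* [q] refines [p] so that one instance [d0] is the largest of all on [q]. *)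
have [q [d0 [qp cd0 max_d0]]] : exists (q : cond) d0, [/\ cle q p, closed d0 &
    forall d h, closed d -> hom h -> sat h q ->
      le3 (h (fsubst x d a)) (h (fsubst x d0 a))].
  have [[d0 [h0 [cd0 hh0 sp0 nz]]]|z] := pselect (exists d0 h0,
      [/\ closed d0, hom h0, sat h0 p & h0 (fsubst x d0 a) <> v0]).
    have [q [qp sq qd]] := cond_cons (inst_sentence cd0) hh0 sp0.
    exists q, d0; split=> // d h cd hh /[dup] sqh /(qp h hh) sph.
    have := le_j d h cd hh sph; rewrite (qd h sqh).
    have := le_j d0 h0 cd0 hh0 sp0.
    by case: (h _) (h0 _) (j) nz nj1 => [] [] [].
  exists p, (cst fa ra (inr 0)); split=> // [y []|d h cd hh sp].
  case e: (h (fsubst x d a)) => //; case: z; exists d, h; split=> //;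
    by rewrite e.
(* [b] is [v0] unless the instance at [d0] is [v1], and then [th] is [v1] anyway. Otherwise [th]
   equals that instance on [q] and is [v1] off [q]. *)
set b := Tri (fsubst x d0 a).
have sd0 := inst_sentence cd0.
pose th := Or (unsat b q) (fsubst x d0 a).
have sth : sentence th.
  by move=> y /= [|/sd0 //]; apply: unsat_sentence => //; apply: clist_closed.
have eth : T (Imp (Ex x a) th).
  apply: theory_ex => [|d cd]; first exact: sth.
  apply: theory_complete => h hh; have [hI hO hT _] := hh.
  rewrite hI hO.
  have [e|ne] := pselect (h (fsubst x d0 a) = v1).
    by rewrite e; case: (h (fsubst x d a)); case: (h (unsat b q)).
  have hb : h b = v0 by rewrite hT; case: (h _) ne.
  have [sq|nsq] := pselect (sat h q).
    rewrite (unsat_v0 hh hb sq); have := max_d0 d h cd hh sq.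
    by case: (h (fsubst x d a)); case: (h (fsubst x d0 a)).
  by rewrite (unsat_nsat hh hb nsq); case: (h (fsubst x d a)); case: (h (fsubst x d0 a)).
have [h hh sq] := clist_sat q; have [_ hO hT _] := hh.
have sp := qp h hh sq; apply: nkj; rewrite -(ek h hh sp).
have l := le_j d0 h cd0 hh sp.
have hb : h b = v0 by rewrite hT; case: (h _) (j) l nj1 => [] [].
by have := hom_imp_le hh eth; rewrite /= hO (unsat_v0 hh hb sq) => /le3_trans; apply.
Qed.

Lemma fname_all : is_glb (@ale Alg) instances (fname (All x a)).
Proof.
split=> [_ [d cd ->]|m lb].
  by apply/(fname_le sA (inst_sentence cd)) => h hh; apply: hom_inst_all.
rewrite (fnameE sA); apply/ale_nameP => p k j mk aj.
have m_le d (cd : closed d) :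
    below (m : name _ _) (sent_name (exist _ _ (inst_sentence cd))).
  have := lb _ (ex_intro2 _ _ d cd erefl).
  by rewrite (fnameE (inst_sentence cd)) => /ale_nameP.
case: k mk => // mk.
(* The witness [g] lies below [m], hence provably below every instance, so [R4] puts it below
   [All x a]. *)
- have [q [g [qp gm gq]]] := forces_wit mk.
  have gall : T (Imp (sval g) (All x a)).
    apply: theory_all => [|d cd]; first exact: svalP g x.
    apply: theory_complete => h hh; have [hI _ _ _] := hh; rewrite hI.
    have := below_trans (@gforces_mono g) gm (m_le d cd).
    have sd := inst_sentence cd.
    have cl : closed_list [:: (sval g, h (sval g)); (fsubst x d a, h (fsubst x d a))].
      by split; [apply: svalP g | split].
    have st : exists2 h', hom h' &
        sat h' [:: (sval g, h (sval g)); (fsubst x d a, h (fsubst x d a))].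
      by exists h.
    by move=> /(_ (MkCond cl st)); apply=> h' _ [? []].
  have [h hh sq] := clist_sat q.
  by have := hom_imp_le hh gall; rewrite (gq h hh sq) (aj h hh (qp h hh sq)).
(* Where [All x a] is not [v1], [b] is [v0] and [th] is the indicator of [p]; on [p] every instance
   is [v1], so [th] lies below all instances and [R4] applies. *)
- set b := Tri (All x a).
  pose th := Imp (unsat b p) b.
  have sth : sentence th.
    by move=> y /= [|/sA //]; apply: unsat_sentence => //; apply: clist_closed.
  have tha : T (Imp th (All x a)).
    apply: theory_all => [|d cd]; first exact: sth.
    apply: theory_complete => h hh; have [hI hO hT _] := hh; rewrite !hI.
    have := hom_inst_all hh cd.
    have [e|ne] := pselect (h (All x a) = v1).
      by rewrite e; case: (h (fsubst x d a)) => // _; apply: imp3_v1.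
    have hb : h b = v0 by rewrite hT; case: (h _) ne.
    move=> _; have [sp|nsp] := pselect (sat h p); last first.
      by rewrite (unsat_nsat hh hb nsp) hb.
    have [q [qp sq qd]] := cond_cons (inst_sentence cd) hh sp.
    have : le3 v1 (h (fsubst x d a)).
      apply: (m_le d cd q); first exact: forces_mono qp mk.
      by move=> h' _; apply: qd.
    by case: (h (fsubst x d a)) => // _; apply: imp3_v1.
  have [h hh sp] := clist_sat p; have [hI _ hT _] := hh.
  have := hom_imp_le hh tha; rewrite hI (aj h hh sp).
  have hb' := hT (All x a); rewrite (aj h hh sp) in hb'.
  have [e|ne] := pselect (j = v1); first by rewrite e.
  have hb : h b = v0 by rewrite hb'; case: (j) ne.
  by rewrite (unsat_v0 hh hb sp) hb.
Qed.

End Quantifiers.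

(** * The structure of closed terms and its truth lemma *)

Definition dom_t := {d : term Th' | closed d}.

Definition fun_t (f : F) (ds : 'I_(fa f) -> dom_t) : dom_t.
Proof.
exists (@Fun Th' f (fun i => sval (ds i))).
by move=> x [i]; apply: (svalP (ds i)).
Defined.

Definition cst_t (c : C + nat) : dom_t.
Proof. by exists (cst fa ra c) => x []. Defined.

(** It interprets the original signature; the new constants enter only through individuals, and
    [inr 0] makes the domain inhabited. *)
Definition term_model : structure Th :=
  @MkStructure Th Alg (@name_alg_complete _ _ cle_refl cle_trans _ _ gforces_mono)
    dom_t (inhabits (cst_t (inr 0))) (fun c => cst_t (inl c)) fun_t
    (fun P ds => fname (@Atom Th' P (fun i => sval (ds i)))).

Definition inst (v : nat -> dom_t) (a : formula Th) : formula Th' :=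
  fmap (fun c => cst fa ra (inl c)) (fun x => sval (v x)) a.

Lemma inst_sent v a : sentence (inst v a).
Proof.
move=> x /free_fmap [c []|y _]; exact: (svalP (v y)).
Qed.

Lemma tval_term_model v t :
  sval (tval (M := term_model) v t) =
  tmap (fun c => cst fa ra (inl c)) (fun x => sval (v x)) t.
Proof.
elim: t => [x|c|f ts IH] //=.
by congr Fun; apply: funext.
Qed.

Lemma fsubst_inst v x (d : dom_t) a :
  fsubst x (sval d) (fmap (fun c => cst fa ra (inl c))
                       (upd (fun y => sval (v y)) x (Var x)) a) =
  inst (update (M := term_model) v x d) a.
Proof.
rewrite fsubst_fmap.
- apply: eq_fmap => y _; rewrite /upd /update.
  by case: eqP.
- by move=> c [].
- by rewrite /upd eqxx.
- by move=> y yx; rewrite /upd; case: eqP => // _; apply: (svalP (v y)).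
Qed.

(** Identifies the set bounded by the semantic clause of a quantifier with [instances], to which
    [fname_all] and [fname_ex] apply. *)
Lemma instances_fval v x (a : formula Th) :
  (forall v, fval (M := term_model) v a = fname (inst v a)) ->
  (fun m => exists d, m = fval (M := term_model) (update v x d) a) =
  instances x (fmap (fun c => cst fa ra (inl c))
                 (upd (fun y => sval (v y)) x (Var x)) a).
Proof.
move=> IH; apply: funext => m; apply: propext; split.
  by move=> [d ->]; exists (sval d); rewrite ?IH ?fsubst_inst //; apply: svalP d.
move=> [d cd ->]; exists (exist _ d cd).
by rewrite IH -fsubst_inst.
Qed.

Lemma fval_term_model v a : fval (M := term_model) v a = fname (inst v a).
Proof.
have free_body (w : nat -> dom_t) x (b : formula Th) y : y <> x -> ~ free y
    (fmap (fun c => cst fa ra (inl c)) (upd (fun z => sval (w z)) x (Var x)) b).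
  move=> yx /free_fmap [c []|z _]; rewrite /upd; case: eqP => [_ /=|_ hy].
    exact: yx.
  exact: (svalP (w z) y).
have sent_body (w : nat -> dom_t) x (b : formula Th) d : closed d -> sentence (fsubst x d
    (fmap (fun c => cst fa ra (inl c)) (upd (fun z => sval (w z)) x (Var x)) b)).
  by move=> cd; rewrite (fsubst_inst w x (exist _ d cd)); apply: inst_sent.
elim: a v => [P ts|a IHa b IHb|a IHa b IHb|a IHa|x a IHa|x a IHa] v /=.
- by congr fname; congr Atom; apply: funext => i; apply: tval_term_model.
- by rewrite IHa IHb; apply/esym/fname_imp; apply: inst_sent.
- by rewrite IHa IHb; apply/esym/fname_or; apply: inst_sent.
- by rewrite IHa; apply/esym/fname_tri; apply: inst_sent.
- rewrite instances_fval //; apply: (@ainfE Alg); apply: fname_all.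
    exact: free_body.
  exact: sent_body.
- rewrite instances_fval //; apply: (@asupE Alg); apply: fname_ex.
    exact: free_body.
  exact: sent_body.
Qed.

Lemma inst_emb v a : sentence a -> inst v a = emb a.
Proof. by move=> sa; apply: eq_fmap => x /sa. Qed.

Lemma term_modelP v a : sentence a ->
  fval (M := term_model) v a = aone (alg term_model) <-> T (emb a).
Proof.
move=> sa; have se : sentence (emb a) by rewrite -(inst_emb v sa); apply: inst_sent.
rewrite fval_term_model inst_emb //; split.
  by move/(fname_v1 se)/theory_complete.
by move=> Ta; apply/(fname_v1 se) => h [_ _ _]; apply.
Qed.

End Canonical.

Theorem mainTheorem6 (Th : signature) (Gamma : formula Th -> Prop)
    (phi : formula Th)
    (hGamma : forall g : formula Th, Gamma g -> sentence g)
    (hphi : sentence phi) :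
  entails Gamma phi -> derivable Gamma phi.
Proof.
case: Th Gamma phi hGamma hphi => C F R fa ra Gamma phi hGamma hphi ent.
(* The new constants are conservative, so it suffices to derive [emb phi] from [embG Gamma]; truth
   of [phi] in the term model of [Gamma] provides this. *)
apply: (@derivable_emb F R fa ra C).
pose v : nat -> dom_t fa ra C := fun=> cst_t fa ra (inr 0).
apply: (term_modelP (G := Gamma) v hphi).1; apply: ent => g Gg w.
by apply: (term_modelP (G := Gamma) w (hGamma _ Gg)).2; apply: Hyp; exists g.
Qed.
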